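(* Let $\rho>0$ and let $\{\mu_k\}_{k\ge 0}\subset(0,\infty)$ satisfy $\mu_{k+1}\ge\mu_k$ for all $k$ and $\sup_k\mu_k<\infty$. Let $Z_k=(L_k,X_k,S_k,Y_k)$, $k\ge1$, denote the iterates generated by the algorithm ADMIPC (described in the context, run without termination), and let $\mathcal{Z}^*$ denote the set of optimal primal-dual pairs of $$\min_{L,X,S\in\mathbb{S}_n}\ \operatorname{Tr}(L)+\rho\|S\|_1\quad\text{s.t.}\quad X=L,\ L\succeq\mathbf{0}_n,\ (X,S)\in\phi,$$ that is, $(L^*,X^*,S^*,Y^* )\in\mathcal{Z}^*$ if and only if $L^*\succeq\mathbf{0}_n$, $(X^*,S^* )\in\phi$, $Y^*\in\mathbb{S}_n$, $X^*=L^*$, and there exists $G\in\partial\|S^*\|_1$ such that $$\langle \mathbf{I}_n-Y^*,L-L^*\rangle\ge0\quad\forall L\succeq\mathbf{0}_n,$$ $$\rho\langle G,S-S^*\rangle+\langle Y^*,X-X^*\rangle\ge0\quad\forall (X,S)\in\phi.$$ Then $\min\{\|Z_k-Z\|_F: Z\in\mathcal{Z}^*\}\to0$ as $k\to\infty$. Moreover, $\{Z_k\}$ is bounded.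
   Context: $\mathbb{S}_n$ is the space of $n\times n$ real symmetric matrices with inner product $\langle A,B\rangle=\operatorname{Tr}(AB)$; $\mathbf{0}_n$, $\mathbf{I}_n$ are the zero and identity matrices; $L\succeq\mathbf{0}_n$ means positive semidefinite and $X\ge\mathbf{0}_n$ entrywise nonnegative; $\|S\|_1=\sum_{i,j}|S_{ij}|$ and $\partial\|\cdot\|_1$ is its subdifferential; $\|\cdot\|_F$ is the Frobenius norm (on tuples of matrices, the square root of the sum of squares of all entries), $\|\cdot\|_2$ the spectral norm, and $\|\cdot\|_\infty$ the maximum absolute value of the entries. Data: $D\in\mathbb{S}_n$ is the node-node incidence matrix of an undirected network on $\mathcal{N}=\{1,\dots,n\}$, with entries in $\{0,1\}$ and $D_{ii}=1$ for all $i$. The set of observable indices is $\Omega=\bar\Omega\cup\mathcal{D}$, where $\mathcal{D}=\{(i,i):i\in\mathcal{N}\}$ and $\bar\Omega\subset(\mathcal{N}\times\mathcal{N})\setminus\mathcal{D}$ is symmetric ($(i,j)\in\bar\Omega\iff(j,i)\in\bar\Omega$). The operator $\pi_\Omega$ is $(\pi_\Omega(Z))_{ij}=Z_{ij}$ if $(i,j)\in\Omega$ and $0$ otherwise. Define $$\phi=\{(X,S)\in\mathbb{S}_n\times\mathbb{S}_n:\ \pi_\Omega(X+S)=\pi_\Omega(D),\ X\ge\mathbf{0}_n,\ \operatorname{diag}(S)=\mathbf{0},\ |S_{ij}|\le1\ \forall i\neq j\}.$$ Algorithm ADMIPC$(\rho,\{\mu_k\})$: initialize $L_0=\mathbf{0}_n$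 and $Y_0=\pi_\Omega(D)/\max\{\|\pi_\Omega(D)\|_2,\ \rho^{-1}\|\pi_\Omega(D)\|_\infty\}$. For $k=0,1,2,\dots$ set $$(X_{k+1},S_{k+1})=\operatorname{argmin}\{\rho\|S\|_1+\tfrac{\mu_k}{2}\|X-L_k+\tfrac{1}{\mu_k}Y_k\|_F^2:\ (X,S)\in\phi\},$$ $$L_{k+1}=\operatorname{argmin}\{\operatorname{Tr}(L)+\tfrac{\mu_k}{2}\|L-X_{k+1}-\tfrac1{\mu_k}Y_k\|_F^2:\ L\succeq\mathbf{0}_n\},$$ $$Y_{k+1}=Y_k+\mu_k(X_{k+1}-L_{k+1}).$$ *)

(* Defs.v *)
From HB Require Import structures.
From mathcomp Require Import all_boot all_order all_algebra.
From mathcomp Require Import all_classical all_reals all_analysis.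

Set Implicit Arguments.
Unset Strict Implicit.
Unset Printing Implicit Defensive.

Import Order.TTheory GRing.Theory Num.Theory.
Import numFieldNormedType.Exports.

Local Open Scope classical_set_scope.
Local Open Scope ring_scope.

Section Optimization.
Variables (R : realType) (T : Type).

(* With attainment: [is_min E m] says that min E exists and equals m. *)
Definition is_min (E : set R) (m : R) : Prop := E m /\ lbound E m.

Definition argmin (f : T -> R) (A : set T) : set T :=
  [set x | A x /\ forall y, A y -> f x <= f y].

End Optimization.

Section Matrices.
Variables (R : realType) (n : nat).

Definition mxdot (A B : 'M[R]_n) : R := \tr (A *m B).

Definition psd (A : 'M[R]_n) : Prop :=
  A \is symmetricmx /\ forall x : 'cV[R]_n, 0 <= (x^T *m A *m x) 0 0.

Definition frob (p q : nat) (A : 'M[R]_(p, q)) : R :=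
  Num.sqrt (\sum_i \sum_j A i j ^+ 2).

Definition norm1 (A : 'M[R]_n) : R := \sum_i \sum_j `|A i j|.

(* On column vectors [frob] is the Euclidean norm, so this is the operator norm
   induced by it. *)
Definition specnorm (A : 'M[R]_n) : R :=
  sup [set frob (A *m x) | x in [set x : 'cV[R]_n | frob x <= 1]].

(* Subdifferential of a function on the Euclidean space of symmetric matrices
   with inner product [mxdot]. *)
Definition subdiff (f : 'M[R]_n -> R) (S : 'M[R]_n) : set 'M[R]_n :=
  [set G | G \is symmetricmx /\
    forall T, T \is symmetricmx -> f S + mxdot G (T - S) <= f T].

Definition quad : Type := 'M[R]_n * 'M[R]_n * 'M[R]_n * 'M[R]_n.

Definition frob4 (Z : quad) : R :=
  let: (L, X, S', Y) := Z in
  Num.sqrt (frob L ^+ 2 + frob X ^+ 2 + frob S' ^+ 2 + frob Y ^+ 2).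

End Matrices.

Section Problem.
Variables (R : realType) (n : nat).
Implicit Types (Om : {set 'I_n * 'I_n}) (D L X S Y : 'M[R]_n).

Definition diag_set : {set 'I_n * 'I_n} :=
  [set ij | ij.1 == ij.2]%SET.

Definition obs_set (Ombar : {set 'I_n * 'I_n}) : {set 'I_n * 'I_n} :=
  Ombar :|: diag_set.

Definition piO Om (Z : 'M[R]_n) : 'M[R]_n :=
  \matrix_(i, j) if (i, j) \in Om then Z i j else 0.

Definition phi Om D : set ('M[R]_n * 'M[R]_n) :=
  [set XS | let: (X, S') := XS in
    [/\ X \is symmetricmx /\ S' \is symmetricmx,
        piO Om (X + S') = piO Om D,
        forall i j, 0 <= X i j,
        forall i, S' i i = 0
      & forall i j, i != j -> `|S' i j| <= 1]].

(* [mx_norm] is the largest absolute value of the entries. *)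
Definition Yinit (rho : R) Om D : 'M[R]_n :=
  (Num.max (specnorm (piO Om D)) (rho^-1 * mx_norm (piO Om D)))^-1
    *: piO Om D.

(* The values [X 0] and [S 0] are not iterates and are left unconstrained. *)
Definition admipc Om D (rho : R) (mu : nat -> R)
    (L X S Y : nat -> 'M[R]_n) : Prop :=
  [/\ L 0%N = 0,
      Y 0%N = Yinit rho Om D
    & forall k : nat,
      [/\ argmin
            (fun XS : 'M[R]_n * 'M[R]_n => rho * norm1 XS.2
               + mu k / 2 * frob (XS.1 - L k + (mu k)^-1 *: Y k) ^+ 2)
            (phi Om D) (X k.+1, S k.+1),
          argmin
            (fun L' => \tr L'
               + mu k / 2 * frob (L' - X k.+1 - (mu k)^-1 *: Y k) ^+ 2)
            (@psd R n) (L k.+1)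
        & Y k.+1 = Y k + mu k *: (X k.+1 - L k.+1)]].

Definition Zstar Om D (rho : R) : set (quad R n) :=
  [set Z | let: (Ls, Xs, Ss, Ys) := Z in
    [/\ psd Ls, phi Om D (Xs, Ss), Ys \is symmetricmx, Xs = Ls
      & exists G, [/\ subdiff (@norm1 R n) Ss G,
          forall L, psd L -> 0 <= mxdot (1%:M - Ys) (L - Ls)
        & forall X S, phi Om D (X, S) ->
            0 <= rho * mxdot G (S - Ss) + mxdot Ys (X - Xs)]]].

End Problem.

(* Main.v *)
Require Import Defs.
From HB Require Import structures.
From mathcomp Require Import all_boot all_order all_algebra.
From mathcomp Require Import all_classical all_reals all_analysis.
From mathcomp Require Import ring lra.

Import Order.TTheory GRing.Theory Num.Theory.
Import numFieldNormedType.Exports.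

(** The convergence proof is the monotonicity argument for the alternating
    direction method of multipliers. The first-order conditions of the two
    minimisations ([lstep_vi], [xstep_vi]) say that the updated multiplier
    [Y k.+1] satisfies the optimality conditions of the problem exactly in [L] and
    up to the residual [mu k (L k.+1 - L k)] in [(X, S)]. Testing them against an
    optimal pair, and two successive [L]-conditions against each other, shows that
    [|L k - L*|^2 + mu_k^-2 |Y k - Y*|^2] decreases for [k >= 1], at each step by at
    least [|L k.+1 - L k|^2 + mu_k^-2 |Y k.+1 - Y k|^2] ([fejer]); this uses that [mu]
    is nondecreasing. Hence the iterates are bounded, because [mu] is, and the steps
    tend to [0]; so do [X k - L k] and the residual.

    Bounded sequences that satisfy the optimality conditions up to vanishing
    residuals accumulate only at optimal pairs ([kkt_limit]). Applied to the
    iterates this makes their distance to the optimal set tend to [0]; applied to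
    sequences of optimal pairs it shows that the distance is attained.

    The argument needs one optimal pair to start from ([Zstar_nonempty]). It is a
    limit of minimisers of the quadratic penalty
    [tr L + rho |S|_1 + c/2 |X - L|^2] as [c] grows: their multipliers [c (X - L)]
    satisfy the optimality conditions, and stay bounded by Slater's argument
    since the identity matrix is feasible and interior to the cone.

    Optimal pairs are handled through the inequality
    [rho (|S|_1 - |S*|_1) + <Y*, X - X*> >= 0], which passes to limits. Its
    equivalence with the existence of a subgradient of the norm is elementary here
    because the norm and the feasible set split over the entries ([Zstar_of_vi]).

    Compactness is used through ultrafilters on the indices: along an ultrafilter
    each bounded sequence of matrices converges entry by entry. *)

Set Implicit Arguments.
Unset Strict Implicit.
Unset Printing Implicit Defensive.

Local Open Scope classical_set_scope.
Local Open Scope ring_scope.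

(** * The entrywise inner product *)

Section EntrywiseInnerProduct.
Variables (R : realType) (n : nat).
Implicit Types (A B C : 'M[R]_n) (c t : R).

(** On symmetric matrices this is [mxdot]; unlike [mxdot] it is positive definite
    on all matrices. *)
Definition dot A B : R := \sum_i \sum_j A i j * B i j.

Lemma symmxP A : reflect (forall i j, A i j = A j i) (A \is symmetricmx).
Proof.
apply: (iffP (is_hermitianmxP _ _ _)) => [/matrixP sA i j|sA].
  by rewrite sA expr0 scale1r !mxE.
by apply/matrixP => i j; rewrite expr0 scale1r !mxE sA.
Qed.

Lemma mxdotE A B : B \is symmetricmx -> mxdot A B = dot A B.
Proof.
move=> /symmxP sB; rewrite /mxdot /mxtrace /dot; apply: eq_bigr => i _.
by rewrite mxE; apply: eq_bigr => j _; rewrite sB.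
Qed.

Lemma dotC A B : dot A B = dot B A.
Proof. by apply: eq_bigr => i _; apply: eq_bigr => j _; rewrite mulrC. Qed.

Lemma dotDl A B C : dot (A + B) C = dot A C + dot B C.
Proof.
rewrite -big_split; apply: eq_bigr => i _ /=; rewrite -big_split.
by apply: eq_bigr => j _ /=; rewrite mxE mulrDl.
Qed.

Lemma dotZl c A B : dot (c *: A) B = c * dot A B.
Proof.
rewrite /dot mulr_sumr; apply: eq_bigr => i _; rewrite mulr_sumr.
by apply: eq_bigr => j _; rewrite mxE mulrA.
Qed.

Lemma dotNl A B : dot (- A) B = - dot A B.
Proof. by rewrite -scaleN1r dotZl mulN1r. Qed.

Lemma dotDr A B C : dot C (A + B) = dot C A + dot C B.
Proof. by rewrite dotC dotDl !(dotC C). Qed.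

Lemma dotZr c A B : dot B (c *: A) = c * dot B A.
Proof. by rewrite dotC dotZl (dotC B). Qed.

Lemma dotNr A B : dot B (- A) = - dot B A.
Proof. by rewrite dotC dotNl (dotC B). Qed.

Definition dot_lin := (dotDl, dotDr, dotZl, dotZr, dotNl, dotNr).

Lemma sqr_entry_le_dot A i j : A i j ^+ 2 <= dot A A.
Proof.
rewrite /dot (bigD1 i) //= (bigD1 j) //= -expr2 -addrA lerDl addr_ge0 //.
  by apply: sumr_ge0 => k _; rewrite -expr2 sqr_ge0.
by do 2!apply: sumr_ge0 => ? _; rewrite -expr2 sqr_ge0.
Qed.

Lemma dot_ge0 A : 0 <= dot A A.
Proof. by do 2!apply: sumr_ge0 => ? _; rewrite -expr2 sqr_ge0. Qed.

Lemma frob_sqr A : frob A ^+ 2 = dot A A.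
Proof.
rewrite /frob sqr_sqrtr; last by do 2!apply: sumr_ge0 => ? _; exact: sqr_ge0.
by do 2!apply: eq_bigr => ? _; rewrite expr2.
Qed.

Lemma entry_le_dot A b i j : dot A A <= b -> `|A i j| <= 1 + b.
Proof.
move=> Ab; have := le_trans (sqr_entry_le_dot A i j) Ab.
rewrite -real_normK ?num_real // => h; nra.
Qed.

Lemma mxtrace_dot A : \tr A = dot 1%:M A.
Proof.
apply: eq_bigr => i _; rewrite (bigD1 i) //= mxE eqxx mul1r big1 ?addr0 //.
by move=> j; rewrite eq_sym => /negPf ji; rewrite mxE ji mul0r.
Qed.

Lemma dot_delta A i j : dot A (delta_mx i j) = A i j.
Proof.
rewrite /dot (bigD1 i) //= (bigD1 j) //= mxE !eqxx mulr1.
rewrite big1 ?big1 ?addr0 // => [a ai|b bj].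
  by apply: big1 => b _; rewrite mxE (negPf ai) mulr0.
by rewrite mxE eqxx (negPf bj) mulr0.
Qed.

Lemma norm1_ge0 A : 0 <= norm1 A.
Proof. by do 2!apply: sumr_ge0 => ? _. Qed.

Lemma norm1_convex A B t : 0 <= t -> t <= 1 ->
  norm1 (A + t *: (B - A)) <= norm1 A + t * (norm1 B - norm1 A).
Proof.
move=> t0 t1; have -> : norm1 A + t * (norm1 B - norm1 A) =
    (1 - t) * norm1 A + t * norm1 B by ring.
rewrite /norm1 !mulr_sumr -big_split; apply: ler_sum => i _ /=.
rewrite !mulr_sumr -big_split; apply: ler_sum => j _ /=; rewrite !mxE.
have -> : A i j + t * (B i j - A i j) = (1 - t) * A i j + t * B i j by ring.
have t1' : 0 <= 1 - t by rewrite subr_ge0.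
by rewrite (le_trans (ler_normD _ _)) // !normrM (ger0_norm t0) (ger0_norm t1').
Qed.

Lemma symmxD A B : A \is symmetricmx -> B \is symmetricmx ->
  A + B \is symmetricmx.
Proof.
by move=> /symmxP sA /symmxP sB; apply/symmxP => i j; rewrite !mxE sA sB.
Qed.

Lemma symmxZ c A : A \is symmetricmx -> c *: A \is symmetricmx.
Proof. by move=> /symmxP sA; apply/symmxP => i j; rewrite !mxE sA. Qed.

Lemma symmxB A B : A \is symmetricmx -> B \is symmetricmx ->
  A - B \is symmetricmx.
Proof. by move=> sA sB; rewrite -scaleN1r symmxD ?symmxZ. Qed.

End EntrywiseInnerProduct.

(** * Positive semidefinite matrices *)

Section PositiveSemidefinite.
Variables (R : realType) (n : nat).
Implicit Types (A B : 'M[R]_n).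

Definition qform A (x : 'cV[R]_n) : R := \sum_i \sum_j x i 0 * A i j * x j 0.

Lemma qformE A x : (x^T *m A *m x) 0 0 = qform A x.
Proof.
rewrite mxE /qform exchange_big /=; apply: eq_bigr => j _.
by rewrite mxE mulr_suml; apply: eq_bigr => i _; rewrite mxE.
Qed.

Lemma psdP A : psd A <-> A \is symmetricmx /\ forall x, 0 <= qform A x.
Proof.
by split=> -[sA pA]; split=> // x; have := pA x; rewrite qformE.
Qed.

Lemma psd_segment A B (t : R) : 0 <= t -> t <= 1 -> psd A -> psd B ->
  psd (A + t *: (B - A)).
Proof.
move=> t0 t1 [sA pA] [sB pB]; split; first by rewrite symmxD ?symmxZ ?symmxB.
move=> x; have := pA x; have := pB x.
rewrite mulmxDr mulmxDl -scalemxAr -scalemxAl mulmxBr mulmxBl !mxE.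
by move=> pBx pAx; nra.
Qed.

Lemma psd_diag_ge0 A i : psd A -> 0 <= A i i.
Proof.
move=> [_ /(_ (delta_mx i 0))]; rewrite trmx_delta -rowE -colE.
by rewrite !mxE.
Qed.

Lemma psd_trace_ge0 A : psd A -> 0 <= \tr A.
Proof. by move=> pA; apply: sumr_ge0 => i _; apply: psd_diag_ge0. Qed.

(** Testing positivity on the vectors [e_i + e_j] and [e_i - e_j] bounds
    [2 |A i j|] by [A i i + A j j]. *)
Lemma psd_entry_le_trace A i j : psd A -> `|A i j| <= \tr A.
Proof.
move=> pA; have dle k : A k k <= \tr A.
  rewrite /mxtrace (bigD1 k) //= lerDl.
  by apply: sumr_ge0 => l _; apply: psd_diag_ge0.
have [/symmxP sA qA] := pA.
have test (c : R) : 0 <= A i i + A j j * c ^+ 2 + 2 * c * A i j.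
  have := qA (delta_mx i 0 + c *: delta_mx j 0).
  rewrite [(_ + _)^T]linearD /= [(_ *: _)^T]linearZ /= !trmx_delta.
  rewrite !(mulmxDl, mulmxDr) -!(scalemxAl, scalemxAr) -!rowE -!colE.
  rewrite !mxE (sA j i).
  by move=> h; rewrite (le_trans h) // le_eqVlt; apply/orP; left; apply/eqP; ring.
have := test 1; have := test (-1); have := dle i; have := dle j.
by move=> h1 h2 h3 h4; rewrite ler_norml; apply/andP; split; lra.
Qed.

Lemma psd_1 : psd (1%:M : 'M[R]_n).
Proof.
apply/psdP; split; first by apply/symmxP => i j; rewrite !mxE eq_sym.
move=> x; rewrite -qformE mulmx1 mxE; apply: sumr_ge0 => i _.
by rewrite mxE -expr2 sqr_ge0.
Qed.

(** The identity is interior to the cone with room [1] in every coordinate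
    direction, because [2 |x i * x j| <= x i ^+ 2 + x j ^+ 2]. *)
Lemma psd_perturb_1 i j (c : R) : `|c| = 1 ->
  psd (1%:M + (c / 2) *: (delta_mx i j + delta_mx j i) : 'M[R]_n).
Proof.
move=> c1; split.
  apply/symmxP => a b; rewrite !mxE (eq_sym a b).
  by congr (_ + _ * _); rewrite addrC; congr (_%:R + _%:R); rewrite andbC.
move=> x; rewrite mulmxDr mulmxDl mulmx1 -scalemxAr -scalemxAl mulmxDr mulmxDl.
have xdx a b : (x^T *m delta_mx a b *m x) 0 0 = x a 0 * x b 0.
  rewrite -(mul_delta_mx (0 : 'I_1)) mulmxA -(mulmxA _ (delta_mx 0 b)).
  by rewrite -rowE -colE mxE big_ord1 !mxE.
rewrite mxE [X in _ + X]mxE [X in _ * X]mxE !xdx (mulrC (x j 0)).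
have le_sum k : x k 0 ^+ 2 <= (x^T *m x) 0 0.
  rewrite mxE (bigD1 k) //= mxE -expr2 lerDl.
  by apply: sumr_ge0 => l _; rewrite mxE -expr2 sqr_ge0.
have := le_sum i; have := le_sum j; move: (x i 0) (x j 0) (_ 0 0) => a b q.
have cE : c = 1 \/ c = - 1.
  by move: c1; case: (ler0P c) => _ h; [right|left]; rewrite -h ?opprK.
have := sqr_ge0 (a + b); have := sqr_ge0 (a - b); rewrite sqrrB sqrrD.
by move: (a ^+ 2) (b ^+ 2) (a * b) => a2 b2 ab ? ? ? ?; case: cE => ->; lra.
Qed.

End PositiveSemidefinite.

(** * Entrywise limits along filters *)

Section UltrafilterLimits.
Variables (R : realType) (n : nat) (T : Type) (F : set_system T).
Implicit Types (A B E : T -> 'M[R]_n) (M N : 'M[R]_n).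

Definition mcvg A M : Prop := forall i j, (fun k => A k i j) @ F --> M i j.

Definition mbounded A : Prop := exists b : R, forall k i j, `|A k i j| <= b.

(** The image filter has a cluster point in a segment; along an ultrafilter a
    cluster point is a limit, since the preimage of a neighbourhood or its
    complement is large. *)
Lemma ultra_bounded_cvg (u : T -> R) (b : R) : UltraFilter F ->
  (forall k, `|u k| <= b) -> exists l : R, u @ F --> l.
Proof.
move=> FU ub; have FP : ProperFilter (u @ F) by apply: fmap_proper_filter.
have [|l [_ ul]] := @segment_compact R (- b) b (u @ F) FP.
  by apply: (@filterE _ F) => k; rewrite /= in_itv /= -ler_norml; exact: ub.
exists l => V lV; have [//|FnV] := in_ultra_setVsetC (u @^-1` V) FU.
by have [x []] := ul (~` V) V FnV lV.
Qed.

Lemma ultra_mbounded_mcvg A : UltraFilter F -> mbounded A ->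
  exists M, mcvg A M.
Proof.
move=> FU [b Ab].
have cA (ij : 'I_n * 'I_n) : exists l : R, (fun k => A k ij.1 ij.2) @ F --> l.
  by apply: (@ultra_bounded_cvg _ b).
have [f fP] := choice cA.
by exists (\matrix_(i, j) f (i, j)) => i j; rewrite mxE; apply: (fP (i, j)).
Qed.

Lemma mcvg_cst M : Filter F -> mcvg (fun=> M) M.
Proof. by move=> FF i j; apply: cvg_cst. Qed.

Lemma mcvgD A B M N : Filter F -> mcvg A M -> mcvg B N ->
  mcvg (fun k => A k + B k) (M + N).
Proof.
move=> FF AM BN i j; rewrite mxE; under eq_fun do rewrite mxE.
exact: cvgD (AM i j) (BN i j).
Qed.

Lemma mcvgN A M : Filter F -> mcvg A M -> mcvg (fun k => - A k) (- M).
Proof.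
move=> FF AM i j; rewrite mxE; under eq_fun do rewrite mxE.
exact: cvgN (AM i j).
Qed.

Lemma mcvgB A B M N : Filter F -> mcvg A M -> mcvg B N ->
  mcvg (fun k => A k - B k) (M - N).
Proof. by move=> FF AM BN; apply: mcvgD => //; apply: mcvgN. Qed.

Lemma cvg_sumr (I : finType) (f : I -> T -> R) (l : I -> R) : Filter F ->
  (forall i, f i @ F --> l i) ->
  (fun k => \sum_i f i k) @ F --> \sum_i l i.
Proof. by move=> FF fl; apply: cvg_big => //; exact: add_continuous. Qed.

Lemma cvg_dot A B M N : Filter F -> mcvg A M -> mcvg B N ->
  (fun k => dot (A k) (B k)) @ F --> dot M N.
Proof.
by move=> FF AM BN; do 2!apply: cvg_sumr => ?; apply: cvgM.
Qed.

Lemma cvg_norm1 A M : Filter F -> mcvg A M ->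
  (fun k => norm1 (A k)) @ F --> norm1 M.
Proof.
by move=> FF AM; do 2!apply: cvg_sumr => ?; apply: cvg_norm.
Qed.

Lemma cvg_ge0 (u : T -> R) (l : R) : ProperFilter F ->
  (forall k, 0 <= u k) -> u @ F --> l -> 0 <= l.
Proof.
move=> FF u0 ul; apply: (@closed_cvg _ _ _ FF u (fun x => 0 <= x)) ul.
- exact: closed_ge.
- exact: nearW.
Qed.

Lemma cvg_le (u : T -> R) (l b : R) : ProperFilter F ->
  (forall k, u k <= b) -> u @ F --> l -> l <= b.
Proof.
move=> FF ub ul; rewrite -subr_ge0; apply: (@cvg_ge0 (fun k => b - u k)) => //.
  by move=> k; rewrite subr_ge0.
by apply: cvgB => //; exact: cvg_cst.
Qed.

Lemma cvg_uniq (u : T -> R) (l m : R) : ProperFilter F ->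
  u @ F --> l -> u @ F --> m -> l = m.
Proof. by move=> FF; apply: cvg_unique; exact: Rhausdorff. Qed.

Lemma mcvg_symm A M : ProperFilter F -> (forall k, A k \is symmetricmx) ->
  mcvg A M -> M \is symmetricmx.
Proof.
move=> FF sA AM; apply/symmxP => i j; apply: cvg_uniq (AM i j) _.
by under eq_fun => k do rewrite (symmxP _ (sA k)); exact: AM.
Qed.

Lemma mcvg_psd A M : ProperFilter F -> (forall k, psd (A k)) ->
  mcvg A M -> psd M.
Proof.
move=> FF pA AM; apply/psdP; split.
  by apply: mcvg_symm AM => // k; case: (pA k).
move=> x; apply: (@cvg_ge0 (fun k => qform (A k) x)).
  by move=> k; case/psdP: (pA k).
do 2!apply: cvg_sumr => ?; apply: cvgM; last exact: cvg_cst.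
by apply: cvgM; [exact: cvg_cst|exact: AM].
Qed.

Lemma mcvg0 E (r : T -> R) : Filter F ->
  (forall k, dot (E k) (E k) <= r k) -> r @ F --> (0 : R) -> mcvg E 0.
Proof.
move=> FF Er r0 i j; rewrite mxE; apply/cvgrPdist_lt => e e0.
move/cvgrPdist_lt: r0 => /(_ (e ^+ 2)); rewrite exprn_gt0 // => /(_ isT).
apply: filterS => k; rewrite !sub0r !normrN => rk.
have h := le_trans (sqr_entry_le_dot (E k) i j) (Er k).
have {h} := le_lt_trans h (le_lt_trans (ler_norm _) rk).
by rewrite -real_normK ?num_real // ltr_pXn2r ?nnegrE ?normr_ge0 // ltW.
Qed.

End UltrafilterLimits.

Section BoundedSequences.
Variables (R : realType) (n : nat) (T : Type).
Implicit Types (A B : T -> 'M[R]_n).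

Lemma mboundedD A B : mbounded A -> mbounded B ->
  mbounded (fun k => A k + B k).
Proof.
move=> [a Aa] [b Bb]; exists (a + b) => k i j; rewrite mxE.
by rewrite (le_trans (ler_normD _ _)) // lerD.
Qed.

Lemma mboundedB A B : mbounded A -> mbounded B ->
  mbounded (fun k => A k - B k).
Proof.
move=> bA [b Bb]; apply: mboundedD => //; exists b => k i j.
by rewrite mxE normrN.
Qed.

Lemma mbounded_dot A (b : R) : (forall k, dot (A k) (A k) <= b) -> mbounded A.
Proof. by move=> Ab; exists (1 + b) => k i j; exact: entry_le_dot. Qed.

End BoundedSequences.

(** A minimising sequence has bounded values, and its values tend to the infimum
    along every ultrafilter containing the cofinite sets; so the value that the
    hypothesis provides as a limit is the infimum. *)
Lemma argmin_exists (R : realType) (T : Type) (f : T -> R) (A : set T) (x0 : T) :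
  A x0 -> (forall x, A x -> 0 <= f x) ->
  (forall (F : set_system nat) (u : nat -> T) (b : R), UltraFilter F ->
     (forall k, A (u k)) -> (forall k, f (u k) <= b) ->
     exists2 x, A x & f \o u @ F --> f x) ->
  exists x, argmin f A x.
Proof.
move=> Ax0 f0 fc; pose E := [set f x | x in A].
have lbE : has_lbound E by exists 0 => _ [x Ax <-]; exact: f0.
have iE : has_inf E by split=> //; exists (f x0), x0.
have approx k : exists x, A x /\ f x < inf E + k.+1%:R^-1.
  have k0 : 0 < k.+1%:R^-1 :> R by rewrite invr_gt0.
  by have [_ [x Ax <-] fx] := inf_adherent k0 iE; exists x.
have [u uP] := choice approx.
have [F [FU oF]] := ultraFilterLemma eventually_filter.
have FP : ProperFilter F by exact: ultra_proper.
have lim_inf : f \o u @ F --> inf E.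
  apply: cvg_trans (cvg_app _ oF) _.
  apply: (@squeeze_cvgr _ _ _ _ (fun=> inf E)
    (fun k => inf E + k.+1%:R^-1)).
  - apply: nearW => k /=; have [Au fu] := uP k.
    by rewrite (ltW fu) andbT ge_inf //; exists (u k).
  - exact: cvg_cst.
  - rewrite -[X in _ --> X]addr0; apply: cvgD; first exact: cvg_cst.
    exact: cvg_harmonic.
have [||x Ax fx] := fc F u (inf E + 1) FU.
- by move=> k; case: (uP k).
- move=> k; have [_ /ltW fu] := uP k; apply: le_trans fu _.
  by rewrite lerD2l invf_le1 ?ler1n.
exists x; split=> // y Ay; rewrite (cvg_uniq FP fx lim_inf).
by apply: ge_inf => //; exists y.
Qed.

(** * The feasible set and the first-order conditions *)

Section FeasibleSet.
Variables (R : realType) (n : nat) (Om : {set 'I_n * 'I_n}) (D : 'M[R]_n).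
Implicit Types (X S : 'M[R]_n) (x s t : R).

(** For symmetric data the feasible set is a product, over unordered pairs of
    indices, of these convex subsets of the plane. *)
Definition phi_entry i j x s : Prop :=
  [/\ (i, j) \in Om -> x + s = D i j, 0 <= x, i = j -> s = 0 & `|s| <= 1].

Lemma phiP X S : phi Om D (X, S) <->
  [/\ X \is symmetricmx, S \is symmetricmx
    & forall i j, phi_entry i j (X i j) (S i j)].
Proof.
split=> [[[sX sS] oXS X0 S0 S1]|[sX sS h]]; split=> //.
- move=> i j; split=> //.
  + by move=> ij; move/matrixP: oXS => /(_ i j); rewrite !mxE ij.
  + by move=> <-.
  + by have [<-|/S1//] := eqVneq i j; rewrite S0 normr0 ler01.
- by apply/matrixP => i j; rewrite !mxE; case: ifP => // ij; case: (h i j) => /(_ ij).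
- by move=> i j; case: (h i j).
- by move=> i; case: (h i i) => _ _ ->.
- by move=> i j _; case: (h i j).
Qed.

Lemma phi_entry_segment i j x s x' s' t : 0 <= t -> t <= 1 ->
  phi_entry i j x s -> phi_entry i j x' s' ->
  phi_entry i j (x + t * (x' - x)) (s + t * (s' - s)).
Proof.
move=> t0 t1 [e x0 d s1] [e' x0' d' s1']; split.
- move=> ij; move: (e ij) (e' ij) => xs x's'; rewrite -[RHS]xs.
  have -> : x' = x + s - s' by lra.
  by ring.
- nra.
- by move=> ij; rewrite d // d' // subrr mulr0 addr0.
- move: s1 s1'; rewrite !ler_norml => /andP[? ?] /andP[? ?].
  by apply/andP; split; nra.
Qed.

Lemma phi_segment X S X' S' t : 0 <= t -> t <= 1 ->
  phi Om D (X, S) -> phi Om D (X', S') ->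
  phi Om D (X + t *: (X' - X), S + t *: (S' - S)).
Proof.
move=> t0 t1 /phiP[sX sS h] /phiP[sX' sS' h']; apply/phiP.
split; [by rewrite symmxD ?symmxZ ?symmxB..|move=> i j].
by rewrite !mxE; apply: phi_entry_segment.
Qed.

Lemma phi_mbounded (T : Type) (X S : T -> 'M[R]_n) :
  (forall k, phi Om D (X k, S k)) -> mbounded S.
Proof.
by move=> h; exists 1 => k i j; have /phiP[_ _ /(_ i j)[]] := h k.
Qed.

Lemma mcvg_phi (T : Type) (F : set_system T) (X S : T -> 'M[R]_n) X' S' :
  ProperFilter F -> (forall k, phi Om D (X k, S k)) ->
  mcvg F X X' -> mcvg F S S' -> phi Om D (X', S').
Proof.
move=> FF h XX' SS'.
have hk k : [/\ X k \is symmetricmx, S k \is symmetricmx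
    & forall i j, phi_entry i j (X k i j) (S k i j)] by apply/phiP.
apply/phiP; split.
- by apply: mcvg_symm XX' => // k; case: (hk k).
- by apply: mcvg_symm SS' => // k; case: (hk k).
move=> i j; split.
- move=> ij; apply: cvg_uniq (cvgD (XX' i j) (SS' i j)) _.
  rewrite (_ : (fun k => X k i j) + (fun k => S k i j) = fun=> D i j).
    exact: cvg_cst.
  by apply/funext => k /=; case: (hk k) => _ _ /(_ i j)[xs _ _ _]; exact: xs.
- by apply: cvg_ge0 (XX' i j) => k; case: (hk k) => _ _ /(_ i j)[].
- move=> ij; apply: cvg_uniq (SS' i j) _.
  rewrite (_ : (fun k => S k i j) = fun=> 0); first exact: cvg_cst.
  by apply/funext => k; case: (hk k) => _ _ /(_ i j)[_ _ ->].
- apply: (cvg_le FF _ (cvg_norm (SS' i j))) => k.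
  by case: (hk k) => _ _ /(_ i j)[].
Qed.

End FeasibleSet.

Section FirstOrderConditions.
Variables (R : realType) (n : nat).
Implicit Types (L X S Y V W : 'M[R]_n).

(** Dividing by [t] and letting it tend to [0] leaves the slope. *)
Lemma slope_ge0 (a b : R) :
  (forall t, 0 < t -> t <= 1 -> 0 <= t * a + t ^+ 2 * b) -> 0 <= a.
Proof.
move=> h; rewrite leNgt; apply/negP => a0.
have b0 := normr_ge0 b; have bb := ler_norm b.
have den : 0 < `|b| - a + 1 by lra.
(* This [t] lies in [(0, 1]] and makes [t * |b|] smaller than [- a]. *)
pose t := - a / (`|b| - a + 1).
have t0 : 0 < t by rewrite divr_gt0 // oppr_gt0.
have t1 : t <= 1 by rewrite ler_pdivrMr // mul1r; lra.
have tden : t * (`|b| - a + 1) = - a by rewrite divfK // gt_eqF.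
have := h t t0 t1; rewrite expr2 -mulrA -mulrDr pmulr_rge0 //; nra.
Qed.

Lemma dot_line V W (t : R) : dot (V + t *: W) (V + t *: W) =
  dot V V + t * (2 * dot V W) + t ^+ 2 * dot W W.
Proof. by rewrite !dot_lin (dotC W V); ring. Qed.

(** Moving from the minimiser towards a point of the convex domain cannot decrease
    the objective to first order. The gradient [m (L1 - X) - Y] of the quadratic
    term is minus the updated multiplier. *)
Lemma lstep_vi X Y L1 (m : R) : 0 < m ->
  argmin (fun L' => \tr L' + m / 2 * frob (L' - X - m^-1 *: Y) ^+ 2)
    (@psd R n) L1 ->
  forall L, psd L -> 0 <= dot (1%:M - (Y + m *: (X - L1))) (L - L1).
Proof.
move=> m0 [pL1 minL1] L pL.
set V := L1 - X - m^-1 *: Y; set W := L - L1.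
have -> : dot (1%:M - (Y + m *: (X - L1))) W = dot 1%:M W + m * dot V W.
  by rewrite /V /W !dot_lin; field; rewrite gt_eqF.
apply: (@slope_ge0 _ (m / 2 * dot W W)) => t t0 t1.
have /minL1 := psd_segment (ltW t0) t1 pL1 pL.
rewrite !frob_sqr.
have -> : L1 + t *: (L - L1) - X - m^-1 *: Y = V + t *: W.
  by rewrite /V -!addrA; congr (_ + _); rewrite addrC !addrA.
have -> : \tr (L1 + t *: (L - L1)) = \tr L1 + t * dot 1%:M W.
  by rewrite !mxtrace_dot dotDr dotZr.
rewrite (dot_line V W) -subr_ge0 => /le_trans; apply.
by rewrite le_eqVlt; apply/orP; left; apply/eqP; field.
Qed.

(** The norm is not differentiated: its convexity along the segment suffices, and
    gives a condition that is stable under limits. *)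
Lemma xstep_vi Om D L Y X1 S1 (rho m : R) : 0 < m -> 0 <= rho ->
  argmin (fun XS : 'M[R]_n * 'M[R]_n => rho * norm1 XS.2
      + m / 2 * frob (XS.1 - L + m^-1 *: Y) ^+ 2) (phi Om D) (X1, S1) ->
  forall X S, phi Om D (X, S) ->
    0 <= rho * (norm1 S - norm1 S1) + dot (Y + m *: (X1 - L)) (X - X1).
Proof.
move=> m0 r0 [p1 min1] X S pXS.
set V := X1 - L + m^-1 *: Y; set W := X - X1.
have -> : dot (Y + m *: (X1 - L)) W = m * dot V W.
  by rewrite /V /W !dot_lin; field; rewrite gt_eqF.
apply: (@slope_ge0 _ (m / 2 * dot W W)) => t t0 t1.
have /min1 /= := phi_segment (ltW t0) t1 p1 pXS.
rewrite !frob_sqr.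
have -> : X1 + t *: (X - X1) - L + m^-1 *: Y = V + t *: W.
  by rewrite /V -!addrA; congr (_ + _); rewrite addrC !addrA.
have := norm1_convex S1 S (ltW t0) t1.
rewrite (dot_line V W) => /(ler_wpM2l r0) hS hm.
rewrite -subr_ge0 in hm; apply: le_trans hm _.
have -> : t * (rho * (norm1 S - norm1 S1) + m * dot V W)
    + t ^+ 2 * (m / 2 * dot W W) = rho * (norm1 S1 + t * (norm1 S - norm1 S1))
    + m / 2 * (dot V V + t * (2 * dot V W) + t ^+ 2 * dot W W)
    - (rho * norm1 S1 + m / 2 * dot V V) by field.
by rewrite !lerD2r.
Qed.

End FirstOrderConditions.

(** * Optimal primal-dual pairs *)

Section OptimalPairs.
Variables (R : realType) (n : nat) (Om : {set 'I_n * 'I_n}) (D : 'M[R]_n).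
Variable rho : R.
Hypothesis rho_gt0 : 0 < rho.
Hypothesis D_sym : D \is symmetricmx.
Hypothesis Om_sym : forall i j, ((i, j) \in Om) = ((j, i) \in Om).
Implicit Types (L X S Y E : 'M[R]_n).

Lemma phi_entryC i j (x s : R) : phi_entry Om D i j x s -> phi_entry Om D j i x s.
Proof.
move=> [xs x0 d s1]; split=> //; last by move=> ij; rewrite d.
by rewrite -Om_sym (symmxP _ D_sym); exact: xs.
Qed.

(** Objective and constraints split over unordered pairs of indices, so the
    inequality may be tested at points that differ from [(Xs, Ss)] in the entries
    [(i, j)] and [(j, i)] only. *)
Lemma entry_vi Xs Ss Y : Y \is symmetricmx -> phi Om D (Xs, Ss) ->
  (forall X S, phi Om D (X, S) ->
     0 <= rho * (norm1 S - norm1 Ss) + dot Y (X - Xs)) ->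
  forall i j x s, phi_entry Om D i j x s ->
    0 <= rho * (`|s| - `|Ss i j|) + Y i j * (x - Xs i j).
Proof.
move=> /symmxP sY /phiP[/symmxP sX /symmxP sS es] vi i j x s xs.
pose c (ab : 'I_n * 'I_n) := (ab == (i, j)) || (ab == (j, i)).
have cC a b : c (a, b) = c (b, a).
  by rewrite /c !xpair_eqE orbC (andbC (a == j)) (andbC (a == i)).
pose X := \matrix_(a, b) if c (a, b) then x else Xs a b.
pose S := \matrix_(a, b) if c (a, b) then s else Ss a b.
have pXS : phi Om D (X, S).
  apply/phiP; split.
  - by apply/symmxP => a b; rewrite !mxE cC sX.
  - by apply/symmxP => a b; rewrite !mxE cC sS.
  move=> a b; rewrite !mxE; case: ifP => [/orP[]/eqP[-> ->]|_] //.
  exact: phi_entryC.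
pose v := rho * (`|s| - `|Ss i j|) + Y i j * (x - Xs i j).
have sum_v : rho * (norm1 S - norm1 Ss) + dot Y (X - Xs) =
    \sum_ab (if c ab then v else 0).
  rewrite -(pair_bigA _ (fun a b => if c (a, b) then v else 0)) /=.
  rewrite /norm1 /dot -sumrB mulr_sumr -big_split; apply: eq_bigr => a _ /=.
  rewrite -sumrB mulr_sumr -big_split; apply: eq_bigr => b _ /=.
  rewrite !mxE; case: ifP => [/orP[]/eqP[-> ->]//|_]; last by rewrite !subrr !mulr0 addr0.
  by rewrite (sY j) (sX j) (sS j).
have := vi X S pXS; rewrite sum_v -big_mkcond sumr_const pmulrn_lge0 //.
by apply/card_gt0P; exists (i, j); rewrite unfold_in /c eqxx.
Qed.

(** On a short enough segment from [s0 != 0] the absolute value is affine. *)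
Lemma sg_segment (s0 s : R) : s0 != 0 -> exists t : R, [/\ 0 < t, t <= 1
  & `|s0 + t * (s - s0)| = `|s0| + t * (Num.sg s0 * (s - s0))].
Proof.
move=> s00; have a0 : 0 < `|s0| by rewrite normr_gt0.
have b0 := normr_ge0 (s - s0); pose t := `|s0| / (`|s0| + `|s - s0|).
have den : 0 < `|s0| + `|s - s0| by lra.
have tden : t * (`|s0| + `|s - s0|) = `|s0| by rewrite divfK // gt_eqF.
have t0 : 0 < t by rewrite divr_gt0.
have t1 : t <= 1 by rewrite ler_pdivrMr // mul1r lerDl.
exists t; split=> //; have tw : t * `|s - s0| <= `|s0| by nra.
have : `|t * (s - s0)| <= `|s0| by rewrite normrM (gtr0_norm t0).
rewrite ler_norml => /andP[]; move: (t * (s - s0)) (mulrCA t (Num.sg s0) (s - s0)).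
move=> w ->; have [sp|sn|z] := ltrgt0P s0; last by rewrite z eqxx in s00.
- by move=> ? ?; rewrite gtr0_sg // mul1r ger0_norm //; lra.
- by move=> ? ?; rewrite ltr0_sg // mulN1r ler0_norm; lra.
Qed.

Lemma clamp_entry (q s : R) : 0 <= `|s| - q * s ->
  0 <= Num.max (-1) (Num.min 1 q) * s - q * s.
Proof.
have [s0|s0] := ltrP 0 s; rewrite ?(gtr0_norm s0) ?(ler0_norm s0) => h.
  have [q1|q1] := leP 1 q; first by rewrite max_r; nra.
  by have [q2|q2] := leP (-1) q; nra.
have [q1|q1] := leP 1 q; first by rewrite max_r; nra.
by have [q2|q2] := leP (-1) q; nra.
Qed.

(** Where [Ss i j = 0] any value in [[-1, 1]] is a subgradient. On an observed entry
    [x = D i j - s], so the pairing with [Y i j] acts on [s] and the value nearest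
    to [Y i j / rho] balances it; elsewhere [x] and [s] are independent and [0]
    will do. *)
Definition subgradient Ss Y : 'M[R]_n :=
  \matrix_(i, j) if Ss i j != 0 then Num.sg (Ss i j)
    else if (i, j) \in Om then Num.max (-1) (Num.min 1 (Y i j / rho)) else 0.

Lemma subgradient_entry Xs Ss Y i j (x s : R) :
  phi_entry Om D i j (Xs i j) (Ss i j) ->
  (forall x s, phi_entry Om D i j x s ->
    0 <= rho * (`|s| - `|Ss i j|) + Y i j * (x - Xs i j)) ->
  phi_entry Om D i j x s ->
  0 <= rho * (subgradient Ss Y i j * (s - Ss i j)) + Y i j * (x - Xs i j).
Proof.
rewrite mxE; move: (Xs i j) (Ss i j) (Y i j) => x0 s0 y e0 vi e.
have [s00|s0n] /= := eqVneq s0 0; last first.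
  have [t [t0 t1 ht]] := sg_segment s s0n.
  have /vi := phi_entry_segment (ltW t0) t1 e0 e.
  rewrite ht => h; rewrite -(pmulr_rge0 _ t0).
  by apply: le_trans h _; rewrite le_eqVlt; apply/orP; left; apply/eqP; ring.
have := vi x s e; subst s0; case: e e0 => xs x_ge0 d s1 [xs0 x0_ge0 d0 _].
case: ifP => [ij|nij] viS; last first.
  have /vi : phi_entry Om D i j x 0.
    by split; rewrite ?nij ?normr0 ?ler01.
  by rewrite subrr mulr0 add0r mul0r mulr0 add0r.
have {}xs : x - x0 = - s by have := xs ij; have := xs0 ij; lra.
have yE : y = rho * (y / rho) by rewrite mulrC divfK // gt_eqF.
move: viS; rewrite xs normr0 !subr0 {1 3}yE -!mulrA -!mulrDr !pmulr_rge0 //.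
by rewrite !mulrA !mulrN; apply: clamp_entry.
Qed.

Lemma subgradientP Ss Y : Y \is symmetricmx -> Ss \is symmetricmx ->
  subdiff (@norm1 R n) Ss (subgradient Ss Y).
Proof.
move=> /symmxP sY sS; have /symmxP eS := sS; split.
  by apply/symmxP => i j; rewrite !mxE eS sY Om_sym.
move=> T sT; rewrite mxdotE ?symmxB // /norm1 /dot -big_split.
apply: ler_sum => i _ /=; rewrite -big_split; apply: ler_sum => j _ /=.
have [g1 gs] : `|subgradient Ss Y i j| <= 1 /\
    subgradient Ss Y i j * Ss i j = `|Ss i j|.
  rewrite mxE; have [->|s0] /= := eqVneq (Ss i j) 0; last first.
    by rewrite normr_sg s0 normrEsg.
  rewrite mulr0 normr0; split=> //; case: ifP => _; last by rewrite normr0 ler01.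
  by rewrite ler_norml le_max lexx ge_max ge_min lexx; apply/andP; split; lra.
move: (subgradient Ss Y i j) g1 gs => g g1 gs.
rewrite !mxE mulrBr gs addrC subrK (le_trans (ler_norm _)) // normrM.
by rewrite -[leRHS]mul1r ler_wpM2r.
Qed.

(** This is the sum rule for the subdifferential of
    [rho |S|_1 + <Ys, X>] over the feasible set, which holds here entry by entry
    without a separation argument. *)
Lemma Zstar_of_vi Ls Ss Ys : psd Ls -> phi Om D (Ls, Ss) -> Ys \is symmetricmx ->
  (forall L, psd L -> 0 <= dot (1%:M - Ys) (L - Ls)) ->
  (forall X S, phi Om D (X, S) ->
     0 <= rho * (norm1 S - norm1 Ss) + dot Ys (X - Ls)) ->
  Zstar Om D rho (Ls, Ls, Ss, Ys).
Proof.
move=> pL pXS sY viL viX; split=> //.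
have /phiP[sL sS es] := pXS.
exists (subgradient Ss Ys); split; first exact: subgradientP.
  by move=> L [sL' pL']; rewrite mxdotE ?symmxB //; apply: viL.
move=> X S /phiP[sX sS' e]; rewrite !mxdotE ?symmxB //.
rewrite /dot mulr_sumr -big_split; apply: sumr_ge0 => i _ /=.
rewrite mulr_sumr -big_split; apply: sumr_ge0 => j _ /=.
rewrite [(S - Ss) i j]mxE [(X - Ls) i j]mxE [(- Ss) i j]mxE [(- Ls) i j]mxE.
by apply: subgradient_entry => //; exact: entry_vi.
Qed.

Lemma Zstar_vi Ls Xs Ss Ys : Zstar Om D rho (Ls, Xs, Ss, Ys) ->
  [/\ Xs = Ls /\ psd Ls, phi Om D (Ls, Ss), Ys \is symmetricmx,
      forall L, psd L -> 0 <= dot (1%:M - Ys) (L - Ls)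
    & forall X S, phi Om D (X, S) ->
        0 <= rho * (norm1 S - norm1 Ss) + dot Ys (X - Ls)].
Proof.
move=> [pL pXS sY XL [G [[sG subG] viL viX]]]; subst Xs.
have /phiP[sL sS _] := pXS.
split=> // [L pL'|X S pXS'].
  by rewrite -mxdotE ?symmxB ?viL //; case: pL'.
have /phiP[sX sS' _] := pXS'.
have := viX X S pXS'; rewrite (mxdotE Ys) ?symmxB // => /le_trans; apply.
by rewrite lerD2r ler_pM2l // lerBrDl; apply: subG.
Qed.

(** Every quantity in the conditions is continuous in the entries, and [X - L -> 0]
    forces [X] and [L] to share their limit. *)
Lemma kkt_limit (F : set_system nat) (L X S Y E : nat -> 'M[R]_n) :
  UltraFilter F ->
  (forall k, psd (L k)) -> (forall k, phi Om D (X k, S k)) ->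
  (forall k, Y k \is symmetricmx) ->
  mbounded L -> mbounded Y ->
  mcvg F (fun k => X k - L k) 0 -> mcvg F E 0 ->
  (forall k L', psd L' -> 0 <= dot (1%:M - Y k) (L' - L k)) ->
  (forall k X' S', phi Om D (X', S') ->
     0 <= rho * (norm1 S' - norm1 (S k)) + dot (Y k + E k) (X' - X k)) ->
  exists Ls Ss Ys, Zstar Om D rho (Ls, Ls, Ss, Ys) /\
    [/\ mcvg F L Ls, mcvg F X Ls, mcvg F S Ss & mcvg F Y Ys].
Proof.
move=> FU pL pXS sY bL bY XL E0 viL viX.
have FP : ProperFilter F by exact: ultra_proper.
have [Ls LLs] := ultra_mbounded_mcvg FU bL.
have [Ys YYs] := ultra_mbounded_mcvg FU bY.
have [Ss SSs] := ultra_mbounded_mcvg FU (phi_mbounded pXS).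
have XLs : mcvg F X Ls.
  rewrite (_ : X = fun k => X k - L k + L k).
    by rewrite -[Ls]add0r; apply: mcvgD.
  by apply/funext => k; rewrite subrK.
exists Ls, Ss, Ys; split=> //; apply: Zstar_of_vi.
- exact: mcvg_psd LLs.
- exact: mcvg_phi XLs SSs.
- exact: mcvg_symm YYs.
- move=> L' pL'; apply: (cvg_ge0 FP (fun k => viL k L' pL')).
  by apply: cvg_dot; apply: mcvgB => //; apply: mcvg_cst.
- move=> X' S' pXS'; apply: (cvg_ge0 FP (fun k => viX k X' S' pXS')).
  apply: cvgD.
    apply: cvgM; first exact: cvg_cst.
    by apply: cvgB; [exact: cvg_cst|exact: cvg_norm1].
  rewrite -[Ys]addr0; apply: cvg_dot; first exact: mcvgD.
  by apply: mcvgB => //; apply: mcvg_cst.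
Qed.

End OptimalPairs.

(** * Existence of an optimal pair *)

Section SaddlePointExistence.
Variables (R : realType) (n : nat) (Om : {set 'I_n * 'I_n}) (D : 'M[R]_n).
Variable rho : R.
Hypothesis rho_gt0 : 0 < rho.
Hypothesis D_sym : D \is symmetricmx.
Hypothesis Om_sym : forall i j, ((i, j) \in Om) = ((j, i) \in Om).
Hypothesis D_01 : forall i j, D i j = 0 \/ D i j = 1.
Hypothesis D_diag : forall i, D i i = 1.
Implicit Types (L X S Y : 'M[R]_n).

(** With this choice of [S] the identity is a feasible, positive definite [X]. *)
Definition slater_S : 'M[R]_n := piO Om (D - 1%:M).

Lemma slater_phi : phi Om D (1%:M, slater_S).
Proof.
apply/phiP; split.
- by apply/symmxP => i j; rewrite !mxE eq_sym.
- by apply/symmxP => i j; rewrite !mxE Om_sym eq_sym (symmxP _ D_sym).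
move=> i j; rewrite !mxE; split.
- by move=> ->; ring.
- by rewrite ler0n.
- by move=> <-; rewrite eqxx D_diag subrr if_same.
- case: ifP => _; last by rewrite normr0 ler01.
  have [->|ij] := eqVneq i j; first by rewrite D_diag subrr normr0 ler01.
  by rewrite subr0; case: (D_01 i j) => ->; rewrite ?normr0 ?normr1 ?ler01.
Qed.

(** Slater's argument: the [L]-condition is tested at a perturbation of the identity
    by [c] in the direction [(i, j)], the [(X, S)]-condition at the identity. In the
    sum only [c * Y i j] is left of the multiplier, besides the pairing
    with [L - X], which has a favourable sign. *)
Lemma multiplier_bound L X S Y i j : psd L -> Y \is symmetricmx ->
  (forall L', psd L' -> 0 <= dot (1%:M - Y) (L' - L)) ->
  (forall X' S', phi Om D (X', S') ->
     0 <= rho * (norm1 S' - norm1 S) + dot Y (X' - X)) ->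
  dot Y (L - X) <= 0 -> `|Y i j| <= n%:R + 1 + rho * norm1 slater_S.
Proof.
move=> pL /symmxP sY viL viX YLX.
have test (c : R) : `|c| = 1 -> c * Y i j <= n%:R + 1 + rho * norm1 slater_S.
  move=> c1; have := viL _ (psd_perturb_1 i j c1); have := viX _ _ slater_phi.
  have := psd_trace_ge0 pL; have := mulr_ge0 (ltW rho_gt0) (norm1_ge0 S).
  have := YLX.
  rewrite !dot_lin !dot_delta (sY j i) mxtrace_dot.
  have -> : dot (1%:M : 'M[R]_n) 1%:M = n%:R by rewrite -mxtrace_dot mxtrace1.
  have d1 : c * (1%:M : 'M[R]_n) i j <= 1.
    rewrite mxE; case: (i == j); rewrite ?mulr1 ?mulr0 ?ler01 //.
    by rewrite -c1 ler_norm.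
  have -> : (1%:M : 'M[R]_n) j i = (1%:M : 'M[R]_n) i j by rewrite !mxE eq_sym.
  move: d1; move: ((1%:M : 'M[R]_n) i j) => d *; lra.
have := test 1; have := test (-1); rewrite normrN normr1 ler_norml.
by move=> /(_ erefl) h1 /(_ erefl) h2; apply/andP; split; lra.
Qed.

Definition penalty (m : R) (p : 'M[R]_n * ('M[R]_n * 'M[R]_n)) : R :=
  let: (L, (X, T)) := p in
  \tr L + rho * norm1 T + m / 2 * dot (X - L) (X - L).

Definition penalty_dom : set ('M[R]_n * ('M[R]_n * 'M[R]_n)) :=
  [set p | psd p.1 /\ phi Om D p.2].

Lemma penalty_terms (m : R) L X S : 0 < m -> psd L ->
  [/\ 0 <= \tr L, 0 <= rho * norm1 S & 0 <= m / 2 * dot (X - L) (X - L)].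
Proof.
move=> m0 pL; split; first exact: psd_trace_ge0.
  by rewrite mulr_ge0 ?norm1_ge0 ?ltW.
by rewrite mulr_ge0 ?dot_ge0 // divr_ge0 // ltW.
Qed.

Lemma penalty_argmin (m : R) : 0 < m ->
  exists p, argmin (penalty m) penalty_dom p.
Proof.
move=> m0; apply: (@argmin_exists _ _ _ _ (1%:M, (1%:M, slater_S))).
- by split; [exact: psd_1|exact: slater_phi].
- move=> [L [X S]] [/= pL _].
  by have [? ? ?] := penalty_terms X S m0 pL; rewrite !addr_ge0.
move=> F u b FU uA ub; have FP : ProperFilter F by exact: ultra_proper.
pose L k := (u k).1; pose X k := (u k).2.1; pose S k := (u k).2.2.
have uE k : u k = (L k, (X k, S k)) by rewrite /L /X /S; case: (u k) => ? [].
have pL k : psd (L k) by case: (uA k).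
have pXS k : phi Om D (X k, S k).
  by case: (uA k) => _; rewrite /X /S; case: (u k).2.
have terms k : \tr (L k) <= b /\ m / 2 * dot (X k - L k) (X k - L k) <= b.
  have [? ? ?] := penalty_terms (X k) (S k) m0 (pL k).
  by have := ub k; rewrite uE /penalty; split; lra.
have bL : mbounded L.
  by exists b => k i j; rewrite (le_trans (psd_entry_le_trace _ _ _)) //;
    case: (terms k).
have bXL : mbounded (fun k => X k - L k).
  apply: (@mbounded_dot _ _ _ _ (b / (m / 2))) => k.
  by rewrite ler_pdivlMr ?divr_gt0 // mulrC; case: (terms k).
have [L' LL'] := ultra_mbounded_mcvg FU bL.
have [V VV] := ultra_mbounded_mcvg FU bXL.
have [S' SS'] := ultra_mbounded_mcvg FU (phi_mbounded pXS).
have XX' : mcvg F X (V + L').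
  rewrite (_ : X = fun k => X k - L k + L k); first exact: mcvgD.
  by apply/funext => k; rewrite subrK.
exists (L', (V + L', S')).
  by split; [exact: mcvg_psd LL'|exact: mcvg_phi XX' SS'].
rewrite (_ : _ \o _ = fun k => dot 1%:M (L k) + rho * norm1 (S k)
    + m / 2 * dot (X k - L k) (X k - L k)); last first.
  by apply/funext => k /=; rewrite uE /penalty mxtrace_dot.
rewrite /penalty mxtrace_dot addrK; apply: cvgD; first apply: cvgD.
- by apply: cvg_dot => //; exact: mcvg_cst.
- by apply: cvgM; [exact: cvg_cst|exact: cvg_norm1].
- by apply: cvgM; [exact: cvg_cst|exact: cvg_dot].
Qed.

Lemma penalty_point (m : R) : 0 < m -> exists L X S,
  [/\ psd L, phi Om D (X, S), penalty m (L, (X, S)) <= n%:R + rho * norm1 slater_S,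
      forall L', psd L' -> 0 <= dot (1%:M - m *: (X - L)) (L' - L)
    & forall X' S', phi Om D (X', S') ->
        0 <= rho * (norm1 S' - norm1 S) + dot (m *: (X - L)) (X' - X)].
Proof.
move=> m0; have [[L [X S]] [[/= pL pXS] minp]] := penalty_argmin m0.
exists L, X, S; split=> //.
- have := minp (1%:M, (1%:M, slater_S)); rewrite [X in _ <= X]/penalty subrr.
  rewrite -(scale0r (1%:M : 'M[R]_n)) dotZl mul0r mulr0 addr0 mxtrace1; apply.
  by split; [exact: psd_1|exact: slater_phi].
(* The penalty is the objective of both steps for the multiplier [0]. *)
- rewrite -[m *: _]add0r; apply: lstep_vi => //; split=> // L' pL'.
  have := minp (L', (X, S)) (conj pL' pXS); rewrite /penalty !scaler0 !subr0.
  rewrite !frob_sqr -!(opprB X) !(dotNl, dotNr) !opprK.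
  by rewrite addrAC [leRHS]addrAC lerD2r.
- rewrite -[m *: _]add0r; apply: (xstep_vi m0 (ltW rho_gt0)).
  split=> // -[X' S'] pXS'.
  have := minp (L, (X', S')) (conj pL pXS'); rewrite /penalty !scaler0 !addr0 /=.
  by rewrite !frob_sqr -!addrA lerD2l.
Qed.

(** Comparison with the Slater point bounds the penalty term uniformly, so [X - L]
    is of order [(k + 1)^(-1/2)], while the multiplier [(k + 1) (X - L)] stays
    bounded by [multiplier_bound]. *)
Lemma Zstar_nonempty : exists Z, Zstar Om D rho Z.
Proof.
pose c k : R := k.+1%:R.
have c0 k : 0 < c k by rewrite ltr0n.
have cQ k : exists p : 'M[R]_n * 'M[R]_n * 'M[R]_n,
    [/\ psd p.1.1, phi Om D (p.1.2, p.2),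
      penalty (c k) (p.1.1, (p.1.2, p.2)) <= n%:R + rho * norm1 slater_S,
      forall L', psd L' -> 0 <= dot (1%:M - c k *: (p.1.2 - p.1.1)) (L' - p.1.1)
    & forall X' S', phi Om D (X', S') -> 0 <= rho * (norm1 S' - norm1 p.2)
        + dot (c k *: (p.1.2 - p.1.1)) (X' - p.1.2)].
  by have [L [X [S h]]] := penalty_point (c0 k); exists (L, X, S).
have [Q QP] := choice cQ.
pose L k := (Q k).1.1; pose X k := (Q k).1.2; pose S k := (Q k).2.
pose Y k := c k *: (X k - L k).
have pL k : psd (L k) by case: (QP k).
have pXS k : phi Om D (X k, S k) by case: (QP k).
have sY k : Y k \is symmetricmx.
  have /phiP[sX _ _] := pXS k; have [sL _] := pL k.
  by rewrite symmxZ ?symmxB.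
pose K := n%:R + rho * norm1 slater_S.
have terms k : \tr (L k) <= K /\ dot (X k - L k) (X k - L k) <= 2 * K / c k.
  have [_ _ h _ _] := QP k; rewrite -/K -/(L k) -/(X k) -/(S k) in h.
  have [? ? ?] := penalty_terms (X k) (S k) (c0 k) (pL k).
  move: h; rewrite /penalty => h; split; first by lra.
  rewrite ler_pdivlMr //; lra.
have bL : mbounded L.
  by exists K => k i j; rewrite (le_trans (psd_entry_le_trace _ _ _)) //;
    case: (terms k).
have bY : mbounded Y.
  exists (n%:R + 1 + rho * norm1 slater_S) => k i j; have [_ _ _ viL viX] := QP k.
  apply: (multiplier_bound _ _ (pL k) (sY k) viL viX).
  rewrite /Y -(opprB (X k)) dotNr dotZl oppr_le0.
  by rewrite mulr_ge0 ?dot_ge0 ?ltW.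
have [F [FU oF]] := ultraFilterLemma eventually_filter.
have FP : ProperFilter F by exact: ultra_proper.
have XL : mcvg F (fun k => X k - L k) 0.
  apply: (mcvg0 (r := fun k => 2 * K / c k) _ (fun k => (terms k).2)).
  apply: cvg_trans (cvg_app _ oF) _.
  rewrite -[X in _ --> X](mulr0 (2 * K)); apply: cvgM; first exact: cvg_cst.
  exact: cvg_harmonic.
have [||Ls [Ss [Ys [ZZ _]]]] :=
  kkt_limit rho_gt0 D_sym Om_sym FU pL pXS sY bL bY XL (mcvg_cst _).
- by move=> k L' pL'; case: (QP k) => _ _ _ viL _; exact: viL.
- by move=> k X' S' pXS'; rewrite addr0; case: (QP k) => _ _ _ _; apply.
by exists (Ls, Ls, Ss, Ys).
Qed.

End SaddlePointExistence.

(** * Asymptotic tools *)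

Section AsymptoticTools.
Variables (R : realType) (n : nat).
Implicit Types (L X S Y : nat -> 'M[R]_n).

(** If a neighbourhood is missed infinitely often, some ultrafilter contains the
    set of indices where it is missed. *)
Lemma cvg_of_ultra (u : nat -> R) (l : R) :
  (forall F : set_system nat, UltraFilter F -> \oo `<=` F -> u @ F --> l) ->
  u @ \oo --> l.
Proof.
move=> h V lV; apply: contrapT => nV.
pose G := within (~` (u @^-1` V)) \oo.
have GP : ProperFilter G.
  apply: Build_ProperFilter => GV; apply: nV.
  by apply: (@filterS _ \oo _ _ _ _ GV) => k kV; apply: contrapT => /kV.
have [F [FU GF]] := ultraFilterLemma GP.
have FP : ProperFilter F by exact: ultra_proper.
have oF : \oo `<=` F by move=> A oA; apply: GF; apply: filterS oA => k Ak _.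
have FnV : F (~` (u @^-1` V)) by apply: GF; apply: (@filterE _ \oo).
have FV : F (u @^-1` V) by exact: (h F FU oF V lV).
by have [x []] := filter_ex (filterI FnV FV).
Qed.

Lemma cvg_decrement (a d : nat -> R) : (forall k, 0 <= a k) ->
  (forall k, 0 <= d k) -> (forall k, a k.+1 + d k <= a k) ->
  d @ \oo --> (0 : R) /\ forall k, a k <= a 0%N.
Proof.
move=> a0 d0 ad; have aS k : a k.+1 <= a k by have := ad k; have := d0 k; lra.
have a_mono : {homo a : i j / (i <= j)%N >-> j <= i} by apply/nonincreasing_seqP.
split; last by move=> k; exact: a_mono.
have ca : cvgn a.
  by apply: nonincreasing_is_cvgn => //; exists 0 => _ [k _ <-].
apply: (@squeeze_cvgr _ _ _ _ (fun=> 0) (fun k => a k - a k.+1)).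
- by apply: nearW => k; rewrite d0 /= lerBrDl.
- exact: cvg_cst.
- rewrite -(subrr (limn a)); apply: cvgB => //.
  by rewrite (cvg_shiftS a).
Qed.

Lemma frob4E (A B C E : 'M[R]_n) :
  frob4 (A, B, C, E) = Num.sqrt (dot A A + dot B B + dot C C + dot E E).
Proof. by rewrite /frob4 !frob_sqr. Qed.

Lemma cvg_frob4 (F : set_system nat) (A B C E : nat -> 'M[R]_n) A' B' C' E' :
  Filter F -> mcvg F A A' -> mcvg F B B' -> mcvg F C C' -> mcvg F E E' ->
  (fun k => frob4 (A k, B k, C k, E k)) @ F --> frob4 (A', B', C', E').
Proof.
move=> FF AA BB CC EE; under eq_fun do rewrite frob4E.
rewrite frob4E; apply: cvg_comp; last exact: sqrt_continuous.
by do ![apply: cvgD; last exact: cvg_dot]; exact: cvg_dot.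
Qed.

Lemma dot_le_frob4 (A B C E : 'M[R]_n) (b : R) : frob4 (A, B, C, E) <= b ->
  [/\ dot A A <= b ^+ 2, dot B B <= b ^+ 2, dot C C <= b ^+ 2
    & dot E E <= b ^+ 2].
Proof.
move=> h; have b0 : 0 <= b by rewrite (le_trans _ h) // sqrtr_ge0.
have := dot_ge0 A; have := dot_ge0 B; have := dot_ge0 C; have := dot_ge0 E.
move=> ? ? ? ?; have : dot A A + dot B B + dot C C + dot E E <= b ^+ 2.
  rewrite -ler_sqrt ?exprn_ge0 // sqrtr_sqr ger0_norm //.
  by move: h; rewrite frob4E.
by move=> ?; split; lra.
Qed.

Lemma mbounded_dot_le (T : Type) (A : T -> 'M[R]_n) : mbounded A ->
  exists c, forall k, dot (A k) (A k) <= c.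
Proof.
move=> [b Ab]; exists (\sum_(i < n) \sum_(j < n) b ^+ 2) => k.
apply: ler_sum => i _; apply: ler_sum => j _.
by rewrite -expr2 -real_normK ?num_real // ler_pXn2r ?nnegrE // (le_trans _ (Ab k i j)).
Qed.

Lemma frob4_bounded (T : Type) (A B C E : T -> 'M[R]_n) :
  mbounded A -> mbounded B -> mbounded C -> mbounded E ->
  exists M, forall k, frob4 (A k, B k, C k, E k) <= M.
Proof.
move=> /mbounded_dot_le[a Aa] /mbounded_dot_le[b Bb] /mbounded_dot_le[c Cc].
move=> /mbounded_dot_le[e Ee]; exists (Num.sqrt (a + b + c + e)) => k.
by rewrite frob4E ler_wsqrtr // !lerD.
Qed.

Lemma mbounded_shift (A : nat -> 'M[R]_n) :
  mbounded (fun k => A k.+1) -> mbounded A.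
Proof.
move=> [b Ab]; exists (Num.max b (1 + dot (A 0%N) (A 0%N))) => -[|k] i j.
  by rewrite le_max entry_le_dot ?orbT.
by rewrite le_max Ab.
Qed.

Lemma mboundedZ (T : Type) (c : T -> R) (A : T -> 'M[R]_n) (c0 : R) :
  (forall k, `|c k| <= c0) -> mbounded A -> mbounded (fun k => c k *: A k).
Proof.
move=> cc [b Ab]; exists (c0 * b) => k i j.
by rewrite mxE normrM ler_pM.
Qed.

Lemma mbounded_cst (T : Type) (M : 'M[R]_n) : mbounded (fun _ : T => M).
Proof. by exists (1 + dot M M) => _ i j; apply: entry_le_dot. Qed.

(** Here [u], [v] are the errors of [L] after and before a step, [p], [q] those
    of [Y]. The three hypotheses add up, with weight [2 / m], to exactly the
    difference of the two sides. *)
Lemma fejer_step (u v p q : 'M[R]_n) (m : R) : 0 < m ->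
  0 <= dot p u ->
  0 <= dot (p + m *: (u - v)) (- (u + m^-1 *: (p - q))) ->
  0 <= dot (p - q) (u - v) ->
  dot u u + m^-1 ^+ 2 * dot p p
    + (dot (u - v) (u - v) + m^-1 ^+ 2 * dot (p - q) (p - q))
  <= dot v v + m^-1 ^+ 2 * dot q q.
Proof.
move=> m0 h1 h2 h3; rewrite -subr_ge0.
have -> : dot v v + m^-1 ^+ 2 * dot q q - (dot u u + m^-1 ^+ 2 * dot p p
    + (dot (u - v) (u - v) + m^-1 ^+ 2 * dot (p - q) (p - q))) =
  2 / m * (dot p u + dot (p + m *: (u - v)) (- (u + m^-1 *: (p - q)))
    + dot (p - q) (u - v)).
  rewrite !dot_lin (dotC v u) (dotC q p) (dotC u p) (dotC v p) (dotC u q).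
  by rewrite (dotC v q); field; rewrite gt_eqF.
by rewrite mulr_ge0 ?divr_ge0 ?addr_ge0 // ltW.
Qed.

End AsymptoticTools.

(** * The iterates *)

Section Iterates.
Variables (R : realType) (n : nat) (Om : {set 'I_n * 'I_n}) (D : 'M[R]_n).
Variable rho : R.
Hypothesis rho_gt0 : 0 < rho.
Hypothesis D_sym : D \is symmetricmx.
Hypothesis Om_sym : forall i j, ((i, j) \in Om) = ((j, i) \in Om).

(** A minimising sequence of optimal pairs is bounded, and [kkt_limit] without
    residuals says that its limits are optimal pairs. *)
Lemma Zstar_nearest (Z W0 : quad R n) : Zstar Om D rho W0 ->
  exists W, argmin (fun W => frob4 (Z - W)) (Zstar Om D rho) W.
Proof.
move=> ZW0; apply: (argmin_exists ZW0) => [W _|F u b FU uZ ub].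
  by case: (Z - W) => [[[? ?] ?] ?]; exact: sqrtr_ge0.
have FP : ProperFilter F by exact: ultra_proper.
case: Z ub => [[[LZ XZ] SZ] YZ] ub.
pose L k := (u k).1.1.1; pose S k := (u k).1.2; pose Y k := (u k).2.
have uP k : u k = (L k, L k, S k, Y k) /\ Zstar Om D rho (L k, L k, S k, Y k).
  rewrite /L /S /Y; move: (uZ k); case: (u k) => [[[L' X'] S'] Y'] /= ZZ.
  by have [[XL _] _ _ _ _] := Zstar_vi rho_gt0 ZZ; subst X'.
have uE k : u k = (L k, L k, S k, Y k) by case: (uP k).
have vi k := Zstar_vi rho_gt0 (uP k).2.
have dist_le k : [/\ dot (LZ - L k) (LZ - L k) <= b ^+ 2,
    dot (XZ - L k) (XZ - L k) <= b ^+ 2, dot (SZ - S k) (SZ - S k) <= b ^+ 2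
    & dot (YZ - Y k) (YZ - Y k) <= b ^+ 2].
  by apply: dot_le_frob4; have := ub k; rewrite uE.
have bounded_of_dist (A : nat -> 'M[R]_n) B :
    (forall k, dot (B - A k) (B - A k) <= b ^+ 2) -> mbounded A.
  move=> BA; rewrite (_ : A = fun k => B - (B - A k)).
    by apply: mboundedB; [exact: mbounded_cst|exact: mbounded_dot BA].
  by apply/funext => k; rewrite subKr.
have bL : mbounded L by apply: (bounded_of_dist _ LZ) => k; case: (dist_le k).
have bY : mbounded Y by apply: (bounded_of_dist _ YZ) => k; case: (dist_le k).
have LL0 : mcvg F (fun k => L k - L k) 0.
  by move=> i j; under eq_fun do rewrite subrr; exact: cvg_cst.
have [|||||||||Ls [Ss [Ys [ZZ [LLs _ SSs YYs]]]]] :=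
  @kkt_limit _ _ Om D rho rho_gt0 D_sym Om_sym F L L S Y (fun=> 0) FU.
- by move=> k; case: (vi k) => -[].
- by move=> k; case: (vi k).
- by move=> k; case: (vi k).
- exact: bL.
- exact: bY.
- exact: LL0.
- exact: mcvg_cst.
- by move=> k; case: (vi k).
- by move=> k X' S' pXS'; rewrite addr0; case: (vi k) => _ _ _ _; apply.
exists (Ls, Ls, Ss, Ys) => //.
rewrite (_ : _ \o _ =
    fun k => frob4 (LZ - L k, XZ - L k, SZ - S k, YZ - Y k)); last first.
  by apply/funext => k /=; rewrite uE.
by apply: cvg_frob4; apply: mcvgB => //; exact: mcvg_cst.
Qed.

Variables (mu : nat -> R) (L X S Y : nat -> 'M[R]_n).
Hypothesis mu_gt0 : forall k, 0 < mu k.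
Hypothesis mu_nondecreasing : forall k, mu k <= mu k.+1.
Hypothesis mu_bounded : has_ubound (range mu).
Hypothesis iterates : admipc Om D rho mu L X S Y.

(** The [(X, S)]-step uses [L k] instead of [L k.+1]: rewritten with the updated
    multiplier, its condition carries the residual [mu k (L k.+1 - L k)]. *)
Lemma iterate_conditions k :
  [/\ psd (L k.+1), phi Om D (X k.+1, S k.+1),
      X k.+1 - L k.+1 = (mu k)^-1 *: (Y k.+1 - Y k),
      forall L', psd L' -> 0 <= dot (1%:M - Y k.+1) (L' - L k.+1)
    & forall X' S', phi Om D (X', S') ->
        0 <= rho * (norm1 S' - norm1 (S k.+1))
          + dot (Y k.+1 + mu k *: (L k.+1 - L k)) (X' - X k.+1)].
Proof.
have [_ _ /(_ k)[minX minL YE]] := iterates.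
have m0 := mu_gt0 k; split.
- by case: minL.
- by case: minX.
- rewrite YE addrAC subrr add0r scalerA mulVf ?scale1r //; exact: lt0r_neq0.
- by rewrite YE; exact: lstep_vi minL.
- have -> : Y k.+1 + mu k *: (L k.+1 - L k) = Y k + mu k *: (X k.+1 - L k).
    by rewrite YE -addrA -scalerDr addrA subrK.
  exact: xstep_vi (ltW rho_gt0) minX.
Qed.

Lemma Y_sym k : Y k \is symmetricmx.
Proof.
have [_ Y0 _] := iterates.
elim: k => [|k sY].
  rewrite Y0 /Yinit symmxZ //; apply/symmxP => i j.
  by rewrite !mxE Om_sym (symmxP _ D_sym).
have [_ _ /(_ k)[_ _ ->]] := iterates.
have [[sL _] /phiP[sX _ _] _ _ _] := iterate_conditions k.
by rewrite symmxD // symmxZ // symmxB.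
Qed.

Lemma mu_mono : {homo mu : i j / (i <= j)%N >-> i <= j}.
Proof. exact/nondecreasing_seqP. Qed.

Definition potential Ls Ys k : R := dot (L k - Ls) (L k - Ls)
  + (mu k)^-1 ^+ 2 * dot (Y k - Ys) (Y k - Ys).

Definition step_gap k : R := dot (L k.+2 - L k.+1) (L k.+2 - L k.+1)
  + (mu k.+1)^-1 ^+ 2 * dot (Y k.+2 - Y k.+1) (Y k.+2 - Y k.+1).

(** The three pairings fed to [fejer_step] come from the conditions at the new
    iterate against the optimal pair and from the two successive [L]-conditions
    against each other. The latter need [L k.+1] to come from a step too, hence
    the index shift. Nondecreasing [mu] lets the weight in [potential] be updated. *)
Lemma fejer Ls Ss Ys k : Zstar Om D rho (Ls, Ls, Ss, Ys) ->
  potential Ls Ys k.+2 + step_gap k <= potential Ls Ys k.+1.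
Proof.
move=> ZZ; have [[_ pLs] pXs sYs viLs viXs] := Zstar_vi rho_gt0 ZZ.
have [pL0 _ _ viL0 _] := iterate_conditions k.
have [pL1 pX1 XLE viL1 viX1] := iterate_conditions k.+1.
have m0 := mu_gt0 k.+1; set m := mu k.+1 in m0 XLE viX1 *.
set L1 := L k.+2 in pL1 XLE viL1 viX1 *; set L0 := L k.+1 in pL0 viL0 viX1 *.
set Y1 := Y k.+2 in XLE viL1 viX1 *; set Y0 := Y k.+1 in viL0 XLE *.
have uv : (L1 - Ls) - (L0 - Ls) = L1 - L0 by rewrite opprB addrA subrK.
have pq : (Y1 - Ys) - (Y0 - Ys) = Y1 - Y0 by rewrite opprB addrA subrK.
have XE : X k.+2 = L1 + m^-1 *: (Y1 - Y0) by rewrite -XLE addrC subrK.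
have := @fejer_step _ _ (L1 - Ls) (L0 - Ls) (Y1 - Ys) (Y0 - Ys) m m0.
rewrite uv pq => step.
have {}step : dot (L1 - Ls) (L1 - Ls) + m^-1 ^+ 2 * dot (Y1 - Ys) (Y1 - Ys)
    + (dot (L1 - L0) (L1 - L0) + m^-1 ^+ 2 * dot (Y1 - Y0) (Y1 - Y0))
    <= dot (L0 - Ls) (L0 - Ls) + m^-1 ^+ 2 * dot (Y0 - Ys) (Y0 - Ys).
  apply: step.
  - have := viL1 _ pLs; have := viLs _ pL1; rewrite -(opprB L1) dotNr.
    have -> : Y1 - Ys = (1%:M - Ys) - (1%:M - Y1).
      by apply/matrixP => i j; rewrite !mxE; ring.
    by rewrite (dotDl (1%:M - Ys)) dotNl => *; lra.
  - have := addr_ge0 (viX1 _ _ pXs) (viXs _ _ pX1).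
    have -> : L1 - Ls + m^-1 *: (Y1 - Y0) = X k.+2 - Ls by rewrite XE addrAC.
    rewrite -(opprB (X k.+2)) !dotNr !dotDl dotNl; lra.
  - have := viL1 _ pL0; have := viL0 _ pL1; rewrite -(opprB L1) dotNr.
    have -> : Y1 - Y0 = (1%:M - Y0) - (1%:M - Y1).
      by apply/matrixP => i j; rewrite !mxE; ring.
    by rewrite (dotDl (1%:M - Y0)) dotNl => *; lra.
apply: le_trans step; rewrite /potential /step_gap lerD2r lerD2l ler_wpM2r ?dot_ge0 //.
rewrite ler_pXn2r ?nnegrE ?invr_ge0 ?(ltW (mu_gt0 _)) // lef_pV2 ?posrE //.
exact: mu_nondecreasing.
Qed.

Lemma iterates_bounded_gap Ls Ss Ys : Zstar Om D rho (Ls, Ls, Ss, Ys) ->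
  [/\ step_gap @ \oo --> (0 : R), mbounded (fun k => L k.+1) & mbounded Y].
Proof.
move=> ZZ; have [M Mub] := mu_bounded.
have muM k : mu k <= M by apply: Mub; exists k.
pose a k := potential Ls Ys k.+1.
have w0 k (A : 'M[R]_n) : 0 <= (mu k)^-1 ^+ 2 * dot A A.
  by rewrite mulr_ge0 ?dot_ge0 ?sqr_ge0.
have [||gap0 a_le] := @cvg_decrement _ a step_gap _ _ (fun k => fejer k ZZ).
- by move=> k; rewrite addr_ge0 ?dot_ge0.
- by move=> k; rewrite addr_ge0 ?dot_ge0.
have of_dist (A : nat -> 'M[R]_n) B c :
    (forall k, dot (A k - B) (A k - B) <= c) -> mbounded A.
  move=> AB; rewrite (_ : A = fun k => (A k - B) + B).
    by apply: mboundedD; [exact: mbounded_dot AB|exact: mbounded_cst].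
  by apply/funext => k; rewrite subrK.
split=> //.
  apply: (of_dist _ Ls (a 0%N)) => k; apply: le_trans (a_le k).
  by rewrite lerDl.
apply: mbounded_shift; apply: (of_dist _ Ys (M ^+ 2 * a 0%N)) => k.
have m0 := mu_gt0 k.+1.
have -> : dot (Y k.+1 - Ys) (Y k.+1 - Ys) = mu k.+1 ^+ 2 *
    ((mu k.+1)^-1 ^+ 2 * dot (Y k.+1 - Ys) (Y k.+1 - Ys)).
  by rewrite mulrA -exprMn divff ?gt_eqF // expr1n mul1r.
apply: ler_pM => //; first by rewrite sqr_ge0.
  by rewrite ler_pXn2r ?nnegrE ?(ltW (mu_gt0 _)) // (le_trans _ (muM k.+1)) // ltW.
by apply: le_trans (a_le k); rewrite lerDr dot_ge0.
Qed.

(** [S] is bounded by feasibility, [X] through the multiplier update. *)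
Lemma X_S_bounded : mbounded (fun k => L k.+1) -> mbounded Y ->
  mbounded (fun k => X k.+1) /\ mbounded (fun k => S k.+1).
Proof.
move=> bL [b Yb]; split; last first.
  apply: (@phi_mbounded _ _ Om D _ (fun k => X k.+1)) => k.
  by case: (iterate_conditions k).
rewrite (_ : (fun k => X k.+1) =
    fun k => (mu k)^-1 *: (Y k.+1 - Y k) + L k.+1); last first.
  apply/funext => k; have [_ _ <- _ _] := iterate_conditions k.
  by rewrite subrK.
apply: mboundedD => //; apply: (@mboundedZ _ _ _ _ _ (mu 0%N)^-1) => [k|].
  rewrite ger0_norm ?invr_ge0 ?(ltW (mu_gt0 k)) // lef_pV2 ?posrE //.
  exact: mu_mono.
by apply: mboundedB; exists b.
Qed.

(** The residuals [X - L] and [mu k (L k.+1 - L k)] of the optimality conditions are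
    both controlled by [step_gap], the second because [mu] is bounded. *)
Lemma iterates_limit (F : set_system nat) : UltraFilter F -> \oo `<=` F ->
  step_gap @ \oo --> (0 : R) -> mbounded (fun k => L k.+1) -> mbounded Y ->
  exists Ls Ss Ys, Zstar Om D rho (Ls, Ls, Ss, Ys) /\
    [/\ mcvg F (fun k => L k.+2) Ls, mcvg F (fun k => X k.+2) Ls,
        mcvg F (fun k => S k.+2) Ss & mcvg F (fun k => Y k.+2) Ys].
Proof.
move=> FU oF gap0 [bl Lb] [b Yb]; have [M Mub] := mu_bounded.
have muM k : mu k <= M by apply: Mub; exists k.
have FP : ProperFilter F by exact: ultra_proper.
have gapF : step_gap @ F --> (0 : R) by apply: cvg_trans (cvg_app _ oF) gap0.
have cond k := iterate_conditions k.+1.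
apply: (@kkt_limit _ _ Om D rho rho_gt0 D_sym Om_sym F _ _ _ _
  (fun k => mu k.+1 *: (L k.+2 - L k.+1)) FU).
- by move=> k; case: (cond k).
- by move=> k; case: (cond k).
- by move=> k; exact: Y_sym.
- by exists bl.
- by exists b.
- apply: (mcvg0 _ _ gapF) => k; have [_ _ -> _ _] := cond k.
  by rewrite dotZl dotZr mulrA -expr2 /step_gap lerDr dot_ge0.
- apply: (@mcvg0 _ _ _ _ _ (fun k => M ^+ 2 * step_gap k)) => [k|].
    rewrite dotZl dotZr mulrA -expr2; apply: ler_pM; rewrite ?dot_ge0 ?sqr_ge0 //.
      by rewrite ler_pXn2r ?nnegrE ?(ltW (mu_gt0 _)) // (le_trans _ (muM k.+1)) // ltW.
    by rewrite /step_gap lerDl mulr_ge0 ?dot_ge0 ?sqr_ge0.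
  by rewrite -[X in _ --> X](mulr0 (M ^+ 2)); apply: cvgM => //; exact: cvg_cst.
- by move=> k; case: (cond k).
- by move=> k; case: (cond k).
Qed.

End Iterates.

(** * Convergence *)

Theorem theorem2p3 (R : realType) (n : nat) (D : 'M[R]_n)
    (Ombar : {set 'I_n * 'I_n})
    (D_sym : D \is symmetricmx)
    (D_01 : forall i j, D i j = 0 \/ D i j = 1)
    (D_diag : forall i, D i i = 1)
    (Ombar_offdiag : forall i j, (i, j) \in Ombar -> i != j)
    (Ombar_sym : forall i j, ((i, j) \in Ombar) = ((j, i) \in Ombar))
    (rho : R) (rho_gt0 : 0 < rho)
    (mu : nat -> R)
    (mu_gt0 : forall k, 0 < mu k)
    (mu_nondecreasing : forall k, mu k <= mu k.+1)
    (mu_bounded : has_ubound (range mu))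
    (L X S Y : nat -> 'M[R]_n)
    (iterates : admipc (obs_set Ombar) D rho mu L X S Y) :
  let Z : nat -> quad R n := fun k => (L k, X k, S k, Y k) in
  (exists d : nat -> R,
     (forall k, (1 <= k)%N ->
        is_min [set frob4 (Z k - W) | W in Zstar (obs_set Ombar) D rho] (d k))
     /\ d @ \oo --> (0 : R))
  /\ (exists M : R, forall k, (1 <= k)%N -> frob4 (Z k) <= M).
Proof.
set Om := obs_set Ombar in iterates *.
have Om_sym i j : ((i, j) \in Om) = ((j, i) \in Om).
  by rewrite !inE Ombar_sym /= eq_sym.
have [[[[Ls Xs] Ss] Ys] ZW0] :=
  Zstar_nonempty rho_gt0 D_sym Om_sym D_01 D_diag.
have [[XL _] _ _ _ _] := Zstar_vi rho_gt0 ZW0; subst Xs.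
have [gap0 bL bY] := iterates_bounded_gap rho_gt0 mu_gt0 mu_nondecreasing
  mu_bounded iterates ZW0.
move=> Z; split; last first.
  have [bX bS] := X_S_bounded rho_gt0 mu_gt0 mu_nondecreasing iterates bL bY.
  have bY1 : mbounded (fun k => Y k.+1) by case: bY => b Yb; exists b.
  have [M ZM] := frob4_bounded bL bX bS bY1.
  by exists M => -[//|k] _; exact: ZM.
have nearest k := Zstar_nearest rho_gt0 D_sym Om_sym (Z k) ZW0.
have [W WP] := choice nearest.
pose d k := frob4 (Z k - W k); exists d; split=> [k _|].
  have [ZW minW] := WP k; split; first by exists (W k).
  by move=> _ [V ZV <-]; exact: minW.
(* [step_gap] controls the residuals from the second iterate on. *)
rewrite -(cvg_shiftn 2); apply: cvg_of_ultra => F FU oF.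
have FP : ProperFilter F by exact: ultra_proper.
have [L' [S' [Y' [ZV [LL XX SS YY]]]]] := iterates_limit rho_gt0 D_sym
  Om_sym mu_gt0 mu_bounded iterates FU oF gap0 bL bY.
pose e k := frob4 (L k.+2 - L', X k.+2 - L', S k.+2 - S', Y k.+2 - Y').
apply: (@squeeze_cvgr _ _ _ _ (fun=> 0) e).
- apply: nearW => k /=; rewrite addn2; have [_ minW] := WP k.+2.
  rewrite {2}/d (minW _ ZV) andbT /d.
  by case: (Z k.+2 - W k.+2) => [[[? ?] ?] ?]; exact: sqrtr_ge0.
- exact: cvg_cst.
have -> : 0 = frob4 (L' - L', L' - L', S' - S', Y' - Y').
  by rewrite frob4E !subrr -(scale0r (0 : 'M[R]_n)) dotZl mul0r !addr0 sqrtr0.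
by apply: cvg_frob4; apply: mcvgB => //; exact: mcvg_cst.
Qed.
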